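(* Let $c\in\mathbb{R}^{S\times A}$ be the true cost matrix with learned $Q$-factor $Q^*=f(c)$, let $w^\dagger:\mathcal S\to\mathcal A$ be any policy, and put $$D_{Q^*}(w^\dagger)=\inf_{Q\in\mathcal V_{w^\dagger}}\Vert Q-Q^*\Vert .$$ If the falsified cost $\tilde c\in\mathbb{R}^{S\times A}$ lies in the open ball $\{\tilde c:\Vert\tilde c-c\Vert<(1-\beta)D_{Q^*}(w^\dagger)\}$ (the robust region of $c$ to $w^\dagger$), then the agent does not learn the policy $w^\dagger$, i.e. $\tilde Q^*=f(\tilde c)\notin\mathcal V_{w^\dagger}$.
   Context: Finite Markov decision process: $\mathcal S=\{1,\dots,S\}$ is a finite state space, $\mathcal A=\{a_1,\dots,a_A\}$ a finite action space, $p(i,j,a)$ is the probability of moving from state $i$ to state $j$ under action $a$ (so $p(i,j,a)\ge 0$, $\sum_j p(i,j,a)=1$), and $\beta\in(0,1)$ is the discount factor. $\Vert\cdot\Vert$ is the maximum norm on $\mathbb{R}^{S\times A}$. The map $f:\mathbb{R}^{S\times A}\to\mathbb{R}^{S\times A}$ sends a cost matrix $d$ to the limit of the $Q$-learning algorithm run with cost $d$, i.e. to the unique $Q\in\mathbb{R}^{S\times A}$ satisfying $$Q(i,a)=d(i,a)+\beta\sum_{j\in\mathcal S}p(i,j,a)\min_{b\in\mathcal A}Q(j,b)\quad\text{for all } i\in\mathcal S,\ a\in\mathcal A.$$ For a policy $w:\mathcal S\to\mathcal A$, $\mathcal V_w=\{Q\in\mathbb{R}^{S\times A}: Q(i,w(i))<Q(i,a)\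 \forall i\in\mathcal S,\ \forall a\ne w(i)\}$. The agent learns the policy $w$ under cost $\tilde c$ if $f(\tilde c)\in\mathcal V_w$. *)

(* Defs.v *)
From HB Require Import structures.
From mathcomp Require Import all_boot all_order all_algebra.
From mathcomp Require Import all_classical all_reals all_analysis.

Set Implicit Arguments.
Unset Strict Implicit.
Unset Printing Implicit Defensive.

Import Order.TTheory GRing.Theory Num.Theory.
Import numFieldNormedType.Exports.

Local Open Scope classical_set_scope.
Local Open Scope ring_scope.

(* The states are 'I_m.+1 and the actions 'I_n.+1, so both spaces are nonempty.
   Costs and Q-factors are matrices, and `|Q| is the library's maximum norm on
   them (mx_norm). *)

(* p i j a is the probability of moving from i to j under a. *)
Definition is_transition (R : realType) (m n : nat)
    (p : 'I_m.+1 -> 'I_m.+1 -> 'I_n.+1 -> R) : Prop :=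
  (forall i j a, 0 <= p i j a) /\ (forall i a, \sum_j p i j a = 1).

(* The initial value Q j ord0 of the iterated minimum is itself one of the
   entries, so this is exactly the minimum of row j. *)
Definition min_action (R : realType) (m n : nat)
    (Q : 'M[R]_(m.+1, n.+1)) (j : 'I_m.+1) : R :=
  \big[Num.min/Q j ord0]_(b < n.+1) Q j b.

Definition bellman (R : realType) (m n : nat)
    (p : 'I_m.+1 -> 'I_m.+1 -> 'I_n.+1 -> R) (beta : R)
    (d Q : 'M[R]_(m.+1, n.+1)) : Prop :=
  forall i a, Q i a = d i a + beta * \sum_j p i j a * min_action Q j.

(* The limit of Q-learning run with cost d, as the unique solution of the fixed
   point equation; learnedQ_spec below shows that, for a transition p and
   0 < beta < 1, the default value 0 is never used and the choice is unique. *)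
Definition learnedQ (R : realType) (m n : nat)
    (p : 'I_m.+1 -> 'I_m.+1 -> 'I_n.+1 -> R) (beta : R)
    (d : 'M[R]_(m.+1, n.+1)) : 'M[R]_(m.+1, n.+1) :=
  xget 0 [set Q | bellman p beta d Q].

Definition Vset (R : realType) (m n : nat) (w : 'I_m.+1 -> 'I_n.+1) :
    set 'M[R]_(m.+1, n.+1) :=
  [set Q | forall i a, a != w i -> Q i (w i) < Q i a].

(* The real infimum is the genuine one: Vset w is nonempty (Vset_neq0) and
   norms are bounded below by 0. *)
Definition distV (R : realType) (m n : nat) (Qs : 'M[R]_(m.+1, n.+1))
    (w : 'I_m.+1 -> 'I_n.+1) : R :=
  inf [set `|Q - Qs| | Q in Vset w].

Lemma Vset_neq0 (R : realType) (m n : nat) (w : 'I_m.+1 -> 'I_n.+1) :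
  @Vset R m n w !=set0.
Proof.
exists (\matrix_(i, a) (a != w i)%:R) => i a aw.
by rewrite !mxE eqxx aw ltr01.
Qed.

Lemma entry_le_norm (R : realType) (m n : nat) (X : 'M[R]_(m.+1, n.+1)) i a :
  `|X i a| <= `|X|.
Proof.
rewrite [leRHS]/Num.Def.normr /= mx_normrE.
exact: (le_bigmax _ (fun ij => `|X ij.1 ij.2|) (i, a)).
Qed.

Lemma norm_le_entries (R : realType) (m n : nat) (X : 'M[R]_(m.+1, n.+1)) e :
  (forall i a, `|X i a| <= e) -> `|X| <= e.
Proof.
move=> Xe; rewrite [leLHS]/Num.Def.normr /= mx_normrE.
apply: bigmax_le => [|[i a] _]; last exact: Xe.
exact: le_trans (normr_ge0 _) (Xe ord0 ord0).
Qed.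

Lemma min_action_lipschitz (R : realType) (m n : nat)
    (P Q : 'M[R]_(m.+1, n.+1)) (j : 'I_m.+1) :
  `|min_action P j - min_action Q j| <= `|P - Q|.
Proof.
have half (X Y : 'M[R]_(m.+1, n.+1)) :
    min_action X j - `|X - Y| <= min_action Y j.
  have entry b : min_action X j - `|X - Y| <= Y j b.
    rewrite lerBlDl; apply: le_trans (bigmin_le _ b _) _.
    rewrite -lerBlDr; apply: le_trans (entry_le_norm _ j b).
    by rewrite !mxE ler_norm.
  by apply: le_bigmin => [|b _]; exact: entry.
have h1 := half P Q; have h2 := half Q P.
rewrite [`|Q - P|]distrC in h2.
by rewrite ler_distl h2 -lerBlDr h1.
Qed.

Definition bellman_op (R : realType) (m n : nat)
    (p : 'I_m.+1 -> 'I_m.+1 -> 'I_n.+1 -> R) (beta : R)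
    (d Q : 'M[R]_(m.+1, n.+1)) : 'M[R]_(m.+1, n.+1) :=
  \matrix_(i, a) (d i a + beta * \sum_j p i j a * min_action Q j).

Lemma bellman_opP (R : realType) (m n : nat)
    (p : 'I_m.+1 -> 'I_m.+1 -> 'I_n.+1 -> R) (beta : R)
    (d Q : 'M[R]_(m.+1, n.+1)) :
  bellman p beta d Q <-> Q = bellman_op p beta d Q.
Proof.
split=> [eqQ|eqQ i a]; last by rewrite {1}eqQ mxE.
by apply/matrixP => i a; rewrite mxE; exact: eqQ.
Qed.

Lemma bellman_op_lipschitz (R : realType) (m n : nat)
    (p : 'I_m.+1 -> 'I_m.+1 -> 'I_n.+1 -> R) (beta : R)
    (d P Q : 'M[R]_(m.+1, n.+1)) :
  is_transition p -> 0 < beta < 1 ->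
  `|bellman_op p beta d P - bellman_op p beta d Q| <= beta * `|P - Q|.
Proof.
move=> [p0 p1] /andP[b0 b1]; apply: norm_le_entries => i a.
rewrite !mxE opprD addrACA subrr add0r -mulrBr normrM (gtr0_norm b0).
rewrite ler_pM2l // -sumrB (le_trans (ler_norm_sum _ _ _)) //.
rewrite -[leRHS]mul1r -(p1 i a) mulr_suml; apply: ler_sum => j _.
rewrite -mulrBr normrM (ger0_norm (p0 _ _ _)).
by rewrite ler_wpM2l // min_action_lipschitz.
Qed.

Lemma learnedQ_spec (R : realType) (m n : nat)
    (p : 'I_m.+1 -> 'I_m.+1 -> 'I_n.+1 -> R) (beta : R)
    (d Q : 'M[R]_(m.+1, n.+1)) :
  is_transition p -> 0 < beta < 1 ->
  bellman p beta d Q <-> Q = learnedQ p beta d.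
Proof.
move=> ptr bb; have /andP[b0 b1] := bb.
pose M : completeNormedModType R := HB.pack 'M[R]_(m.+1, n.+1)
  (NormedModule.on 'M[R]_(m.+1, n.+1)) (Complete.on 'M[R]_(m.+1, n.+1)).
pose T : M -> M := bellman_op p beta d.
have fT : set_fun [set: M] [set: M] T by [].
pose T' : {fun [set: M] >-> [set: M]} := HB.pack T (isFun.Build _ _ _ _ T fT).
have ctr : is_contraction T'.
  exists (NngNum (ltW b0)); split=> //= -[x y] _ /=.
  exact: bellman_op_lipschitz.
have [Q0 _ fixQ0] := banach_fixed_point ctr closedT (ex_intro _ (0 : M) I).
have uniq X Y : bellman p beta d X -> bellman p beta d Y -> X = Y.
  move=> /bellman_opP XT /bellman_opP YT.
  exact: (contraction_fixpoint_unique ctr).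
have solved : bellman p beta d (learnedQ p beta d).
  rewrite /learnedQ; case: xgetP => [X _ //|/(_ Q0)].
  by case; apply/bellman_opP.
by split=> [QB|->//]; exact: uniq.
Qed.

(* Main.v *)
Require Import Defs.
From HB Require Import structures.
From mathcomp Require Import all_boot all_order all_algebra.
From mathcomp Require Import all_classical all_reals all_analysis.

Set Implicit Arguments.
Unset Strict Implicit.
Unset Printing Implicit Defensive.

Import Order.TTheory GRing.Theory Num.Theory.
Import numFieldNormedType.Exports.

Local Open Scope classical_set_scope.
Local Open Scope ring_scope.

(** The learned Q-factor is a Lipschitz function of the cost with constant 1/(1 - beta): it is the
    fixed point of a beta-contraction that the cost only translates ([learnedQ_lipschitz]). A
    falsification smaller than (1 - beta) D thus moves the Q-factor by less than D, whereas every
    point of [Vset w] is at distance at least D from the original one ([distV_le]). *)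

Lemma bellman_opB_cost (R : realType) (m n : nat)
    (p : 'I_m.+1 -> 'I_m.+1 -> 'I_n.+1 -> R) (beta : R)
    (d e Q : 'M[R]_(m.+1, n.+1)) :
  bellman_op p beta d Q - bellman_op p beta e Q = d - e.
Proof. by apply/matrixP => i a; rewrite !mxE opprD addrACA subrr addr0. Qed.

Lemma learnedQE (R : realType) (m n : nat)
    (p : 'I_m.+1 -> 'I_m.+1 -> 'I_n.+1 -> R) (beta : R)
    (d : 'M[R]_(m.+1, n.+1)) :
  is_transition p -> 0 < beta < 1 ->
  learnedQ p beta d = bellman_op p beta d (learnedQ p beta d).
Proof. by move=> hp hb; apply/bellman_opP/learnedQ_spec. Qed.

Lemma learnedQ_lipschitz (R : realType) (m n : nat)
    (p : 'I_m.+1 -> 'I_m.+1 -> 'I_n.+1 -> R) (beta : R)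
    (d e : 'M[R]_(m.+1, n.+1)) :
  is_transition p -> 0 < beta < 1 ->
  (1 - beta) * `|learnedQ p beta d - learnedQ p beta e| <= `|d - e|.
Proof.
move=> hp hb; rewrite mulrBl mul1r lerBlDr.
set P := learnedQ p beta d; set Q := learnedQ p beta e.
(* Insert [bellman_op p beta e P] between the fixed points: the change of cost contributes exactly
   [d - e], and the rest contracts by [beta]. *)
have PQ : P - Q = (d - e) + (bellman_op p beta e P - bellman_op p beta e Q).
  by rewrite -(bellman_opB_cost p beta d e P) addrA subrK -!learnedQE.
rewrite {1}PQ; apply: le_trans (ler_normD _ _) _.
by rewrite lerD2l; exact: bellman_op_lipschitz.
Qed.

Lemma distV_le (R : realType) (m n : nat) (Q Qs : 'M[R]_(m.+1, n.+1))
    (w : 'I_m.+1 -> 'I_n.+1) :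
  Vset w Q -> distV Qs w <= `|Q - Qs|.
Proof.
move=> wQ; apply: ge_inf; last by exists Q.
(* A real infimum bounds its set from below only if some lower bound exists; here 0 is one. *)
by exists 0 => _ [X _ <-]; exact: normr_ge0.
Qed.

Theorem mainTheorem3 (R : realType) (m n : nat)
    (p : 'I_m.+1 -> 'I_m.+1 -> 'I_n.+1 -> R) (beta : R)
    (hp : is_transition p) (hbeta : 0 < beta < 1)
    (c : 'M[R]_(m.+1, n.+1)) (w : 'I_m.+1 -> 'I_n.+1)
    (ct : 'M[R]_(m.+1, n.+1)) :
  `|ct - c| < (1 - beta) * distV (learnedQ p beta c) w ->
  ~ Vset w (learnedQ p beta ct).
Proof.
move=> small learned; have /andP[_ b1] := hbeta.
have := le_lt_trans (learnedQ_lipschitz ct c hp hbeta) small.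
(* Cancelling [1 - beta > 0] puts a point of [Vset w] strictly closer than the infimum. *)
by rewrite ltr_pM2l ?subr_gt0// ltNge distV_le.
Qed.
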